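(* For a semiring $S$ the following conditions are equivalent: (1) $S$ is a left Noetherian ring. (2) Every direct sum of e-injective left $S$-semimodules is e-injective, and the left $S$-semimodule $S/V(S)$ can be embedded in an e-injective left $S$-semimodule.
   Context: A semiring is $(S,+,\cdot,0,1)$ with $(S,+,0)$ a commutative monoid, $(S,\cdot,1)$ a monoid, multiplication distributing over addition on both sides, and $0s=0=s0$ for all $s$. A left $S$-semimodule is a commutative monoid $(M,+,0)$ with a scalar multiplication $S\times M\to M$ satisfying $(ss')m=s(s'm)$, $s(m+m')=sm+sm'$, $(s+s')m=sm+s'm$, $1m=m$, $s0=0=0m$. Homomorphisms preserve $+$, $0$ and scalar multiplication; ${}_S\mathcal{M}$ is the category of left $S$-semimodules and $\mathcal{M}$ the category of commutative monoids. Direct sums are coproducts in ${}_S\mathcal{M}$ (families of finite support), over arbitrary index sets. $V(S)=\{s\in S\mid s+s'=0\text{ for some }s'\in S\}$. For a subsemimodule $L$ of a left $S$-semimodule $M$, $M/L$ is the quotient of $M$ by the Bourne congruence: $m\equiv_L m'$ iff $m+l=m'+l'$ for some $l,l'\in L$. Here $S/V(S)$ is this quotient for $M={}_SS$, $L=V(S)$. A sequence $0\to A\xrightarrow{f}B\xrightarrow{g}C\to 0$ in ${}_S\mathcal{M}$ (or in $\mathcal{M}$) is short exact if $f$ is a categorical kernel of $g$ and $g$ is a categorical cokernel of $f$ (kernels and cokernels in the sense of categories with zero morphisms). $M\in{}_S\mathcal{M}$ is e-injective if the contravariant functor $\mathrm{Hom}_S(-,M):{}_S\mathcal{M}\to\mathcal{M}$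 sends every short exact sequence $0\to A\to B\to C\to 0$ to a short exact sequence $0\to\mathrm{Hom}_S(C,M)\to\mathrm{Hom}_S(B,M)\to\mathrm{Hom}_S(A,M)\to 0$ in $\mathcal{M}$. *)

(* Defs.v *)
From HB Require Import structures.
From mathcomp Require Import all_boot all_algebra generic_quotient.
From mathcomp Require Import boolp classical_sets cardinality.

Set Implicit Arguments.
Unset Strict Implicit.
Unset Printing Implicit Defensive.

Import GRing.Theory.
Local Open Scope ring_scope.
Local Open Scope quotient_scope.

(* Semirings are [pzSemiRingType]s, since 0 = 1 is not excluded; the left
   S-semimodules are the [lSemiModType S]s and their homomorphisms are the
   [{linear A -> B}]s; commutative monoids are [nmodType]s and their
   homomorphisms are the [{additive U -> V}]s. Subsemimodules are
   [submodClosed]s: with [asbool], boolean predicates lose no generality. *)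

Section SemimoduleCategory.
Context (S : pzSemiRingType).
Implicit Types A B C X : lSemiModType S.

Definition is_kernel A B C (f : {linear A -> B}) (g : {linear B -> C}) : Prop :=
  (forall a, g (f a) = 0) /\
  forall X (h : {linear X -> B}), (forall x, g (h x) = 0) ->
    exists! k : {linear X -> A}, f \o k =1 h.

Definition is_cokernel A B C (f : {linear A -> B}) (g : {linear B -> C}) : Prop :=
  (forall a, g (f a) = 0) /\
  forall X (h : {linear B -> X}), (forall a, h (f a) = 0) ->
    exists! k : {linear C -> X}, k \o g =1 h.

Definition short_exact A B C (f : {linear A -> B}) (g : {linear B -> C}) : Prop :=
  is_kernel f g /\ is_cokernel f g.

End SemimoduleCategory.

Section MonoidCategory.
Implicit Types A B C X : nmodType.

Definition is_monoid_kernel A B C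
    (f : {additive A -> B}) (g : {additive B -> C}) : Prop :=
  (forall a, g (f a) = 0) /\
  forall X (h : {additive X -> B}), (forall x, g (h x) = 0) ->
    exists! k : {additive X -> A}, f \o k =1 h.

Definition is_monoid_cokernel A B C
    (f : {additive A -> B}) (g : {additive B -> C}) : Prop :=
  (forall a, g (f a) = 0) /\
  forall X (h : {additive B -> X}), (forall a, h (f a) = 0) ->
    exists! k : {additive C -> X}, k \o g =1 h.

Definition monoid_short_exact A B C
    (f : {additive A -> B}) (g : {additive B -> C}) : Prop :=
  is_monoid_kernel f g /\ is_monoid_cokernel f g.

End MonoidCategory.

(* S is not commutative, so that Hom_S(A, M) is only a commutative monoid. *)
Definition homS (S : pzSemiRingType) (A M : lSemiModType S) : Type :=
  {linear A -> M}.

Section HomMonoid.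
Context (S : pzSemiRingType) (A M : lSemiModType S).
Implicit Types h k : {linear A -> M}.

Lemma homS_ext h k : h =1 k -> h = k.
Proof.
case: h => h [[ha] [hl]]; case: k => k [[ka] [kl]] /= /funext hk.
by subst k; rewrite (Prop_irrelevance ka ha) (Prop_irrelevance kl hl).
Qed.

Fact hom_zero_semilinear : semilinear (fun _ : A => 0 : M).
Proof. by split=> [a x|x y]; rewrite ?scaler0 ?addr0. Qed.

Definition hom_zero : homS A M :=
  HB.pack_for {linear A -> M} (fun _ : A => 0 : M)
    (GRing.isSemilinear.Build S A M *:%R (fun _ : A => 0 : M)
       hom_zero_semilinear).

Fact hom_add_semilinear h k : semilinear (fun x => h x + k x).
Proof.
by split=> [a x|x y]; rewrite ?linearZ_LR ?scalerDr // !linearD addrACA.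
Qed.

Definition hom_add h k : homS A M :=
  HB.pack_for {linear A -> M} (fun x => h x + k x)
    (GRing.isSemilinear.Build S A M *:%R (fun x => h x + k x)
       (hom_add_semilinear h k)).

HB.instance Definition _ := gen_eqMixin (homS A M).
HB.instance Definition _ := gen_choiceMixin (homS A M).

Fact hom_addA : associative (hom_add : homS A M -> homS A M -> homS A M).
Proof. by move=> h k l; apply: homS_ext => x /=; rewrite addrA. Qed.

Fact hom_addC : commutative (hom_add : homS A M -> homS A M -> homS A M).
Proof. by move=> h k; apply: homS_ext => x /=; rewrite addrC. Qed.

Fact hom_add0 : left_id hom_zero (hom_add : homS A M -> homS A M -> homS A M).
Proof. by move=> h; apply: homS_ext => x /=; rewrite add0r. Qed.

HB.instance Definition _ :=
  GRing.isNmodule.Build (homS A M) hom_addA hom_addC hom_add0.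

End HomMonoid.

Section ContravariantHom.
Context (S : pzSemiRingType) (M A B : lSemiModType S) (f : {linear A -> B}).

Definition hom_pre (h : homS B M) : homS A M :=
  ((h : {linear B -> M}) \o f : {linear A -> M}).

Fact hom_pre_additive : nmod_morphism hom_pre.
Proof. by split=> [|h k]; apply: homS_ext. Qed.

HB.instance Definition _ :=
  GRing.isNmodMorphism.Build (homS B M) (homS A M) hom_pre hom_pre_additive.

End ContravariantHom.

Arguments hom_pre {S} M {A B} f.

Definition e_injective (S : pzSemiRingType) (M : lSemiModType S) : Prop :=
  forall (A B C : lSemiModType S) (f : {linear A -> B}) (g : {linear B -> C}),
    short_exact f g -> monoid_short_exact (hom_pre M g) (hom_pre M f).

Section DirectSum.
Context (S : pzSemiRingType) (I : Type) (M : I -> lSemiModType S).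

Record dsum : Type := DSum {
  dsum_val :> forall i, M i;
  dsum_finite : finite_set [set i | dsum_val i <> 0]
}.

Lemma dsum_ext (x y : dsum) : (forall i, x i = y i) -> x = y.
Proof.
case: x => x xf; case: y => y yf /= xy.
have {}xy : x = y by apply: functional_extensionality_dep.
by subst y; rewrite (Prop_irrelevance xf yf).
Qed.

Fact dsum_zero_finite : finite_set [set i | (0 : M i) <> 0].
Proof. by rewrite [X in finite_set X](_ : _ = set0) // -subset0 => i /=. Qed.

Definition dsum_zero : dsum := DSum dsum_zero_finite.

Fact dsum_add_finite (x y : dsum) : finite_set [set i | x i + y i <> 0].
Proof.
apply: (@sub_finite_set _ _ ([set i | x i <> 0] `|` [set i | y i <> 0])%classic).
  move=> i /= xy0; case: (pselect (x i = 0)) => [x0|]; last by left.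
  by right=> y0; apply: xy0; rewrite x0 y0 addr0.
by rewrite finite_setU; split; apply: dsum_finite.
Qed.

Definition dsum_add (x y : dsum) : dsum := DSum (dsum_add_finite x y).

Fact dsum_scale_finite (s : S) (x : dsum) : finite_set [set i | s *: x i <> 0].
Proof.
apply: sub_finite_set (dsum_finite x) => i /= sx0 x0.
by apply: sx0; rewrite x0 scaler0.
Qed.

Definition dsum_scale (s : S) (x : dsum) : dsum := DSum (dsum_scale_finite s x).

HB.instance Definition _ := gen_eqMixin dsum.
HB.instance Definition _ := gen_choiceMixin dsum.

Fact dsum_addA : associative dsum_add.
Proof. by move=> x y z; apply: dsum_ext => i /=; rewrite addrA. Qed.
Fact dsum_addC : commutative dsum_add.
Proof. by move=> x y; apply: dsum_ext => i /=; rewrite addrC. Qed.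
Fact dsum_add0 : left_id dsum_zero dsum_add.
Proof. by move=> x; apply: dsum_ext => i /=; rewrite add0r. Qed.

HB.instance Definition _ :=
  GRing.isNmodule.Build dsum dsum_addA dsum_addC dsum_add0.

Fact dsum_scaleA a b x : dsum_scale a (dsum_scale b x) = dsum_scale (a * b) x.
Proof. by apply: dsum_ext => i /=; rewrite scalerA. Qed.
Fact dsum_scale0 x : dsum_scale 0 x = 0.
Proof. by apply: dsum_ext => i /=; rewrite scale0r. Qed.
Fact dsum_scale1 : left_id 1 dsum_scale.
Proof. by move=> x; apply: dsum_ext => i /=; rewrite scale1r. Qed.
Fact dsum_scaleDr : right_distributive dsum_scale +%R.
Proof. by move=> a x y; apply: dsum_ext => i /=; rewrite scalerDr. Qed.
Fact dsum_scaleDl x : {morph dsum_scale^~ x : a b / a + b}.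
Proof. by move=> a b; apply: dsum_ext => i /=; rewrite scalerDl. Qed.

HB.instance Definition _ := GRing.Nmodule_isLSemiModule.Build S dsum
  dsum_scaleA dsum_scale0 dsum_scale1 dsum_scaleDr dsum_scaleDl.

End DirectSum.

Section BourneQuotient.
Context (S : pzSemiRingType) (M : lSemiModType S) (L : submodClosed M).

Definition bourne (m m' : M) : Prop :=
  exists l l', [/\ l \in L, l' \in L & m + l = m' + l'].

Fact bourne_refl : reflexive (fun m m' => `[< bourne m m' >]).
Proof. by move=> m; apply/asboolP; exists 0, 0; rewrite !rpred0. Qed.

Fact bourne_sym : symmetric (fun m m' => `[< bourne m m' >]).
Proof.
by move=> m m'; apply: asbool_equiv_eq; split=> -[l [l' [? ? ?]]]; exists l', l.
Qed.

Fact bourne_trans : transitive (fun m m' => `[< bourne m m' >]).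
Proof.
move=> y x z /asboolP[l [l' [Ll Ll' e]]] /asboolP[k [k' [Lk Lk' e']]].
apply/asboolP; exists (l + k), (k' + l'); split; rewrite ?rpredD //.
by rewrite addrA e addrAC e' addrA.
Qed.

Definition bourne_equiv : equiv_rel M :=
  EquivRel (fun m m' => `[< bourne m m' >]) bourne_refl bourne_sym bourne_trans.

Definition bourne_quot : Type := {eq_quot bourne_equiv}.

HB.instance Definition _ := Choice.on bourne_quot.
HB.instance Definition _ := EqQuotient.on bourne_quot.

Definition bourne_pi (m : M) : bourne_quot := \pi_bourne_quot m.

Lemma bourne_piP (m m' : M) : bourne_pi m = bourne_pi m' <-> bourne m m'.
Proof. by split=> [/eqmodP/asboolP|h]; [|apply/eqmodP/asboolP]. Qed.

Lemma bourne_reprK (x : bourne_quot) : bourne_pi (repr x) = x.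
Proof. exact: reprK. Qed.

Definition bourne_zero : bourne_quot := bourne_pi 0.
Definition bourne_add (x y : bourne_quot) : bourne_quot :=
  bourne_pi (repr x + repr y).
Definition bourne_scale (s : S) (x : bourne_quot) : bourne_quot :=
  bourne_pi (s *: repr x).

Lemma bourne_pi_add m m' :
  bourne_add (bourne_pi m) (bourne_pi m') = bourne_pi (m + m').
Proof.
apply/bourne_piP.
have /bourne_piP[l [l' [Ll Ll' e]]] := bourne_reprK (bourne_pi m).
have /bourne_piP[k [k' [Lk Lk' e']]] := bourne_reprK (bourne_pi m').
by exists (l + k), (l' + k'); split; rewrite ?rpredD // addrACA e e' addrACA.
Qed.

Lemma bourne_pi_scale s m : bourne_scale s (bourne_pi m) = bourne_pi (s *: m).
Proof.
apply/bourne_piP.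
have /bourne_piP[l [l' [Ll Ll' e]]] := bourne_reprK (bourne_pi m).
by exists (s *: l), (s *: l'); split; rewrite ?rpredZ // -!scalerDr e.
Qed.

Fact bourne_addA : associative bourne_add.
Proof.
move=> x y z; rewrite -[x]bourne_reprK -[y]bourne_reprK -[z]bourne_reprK.
by rewrite !bourne_pi_add addrA.
Qed.
Fact bourne_addC : commutative bourne_add.
Proof. by move=> x y; rewrite /bourne_add addrC. Qed.
Fact bourne_add0 : left_id bourne_zero bourne_add.
Proof. by move=> x; rewrite -[x]bourne_reprK bourne_pi_add add0r. Qed.

HB.instance Definition _ :=
  GRing.isNmodule.Build bourne_quot bourne_addA bourne_addC bourne_add0.

Lemma bourne_piD m m' : bourne_pi m + bourne_pi m' = bourne_pi (m + m').
Proof. exact: bourne_pi_add. Qed.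

Fact bourne_scaleA a b x :
  bourne_scale a (bourne_scale b x) = bourne_scale (a * b) x.
Proof. by rewrite -[x]bourne_reprK !bourne_pi_scale scalerA. Qed.
Fact bourne_scale0 x : bourne_scale 0 x = 0.
Proof. by rewrite -[x]bourne_reprK bourne_pi_scale scale0r. Qed.
Fact bourne_scale1 : left_id 1 bourne_scale.
Proof. by move=> x; rewrite -[x]bourne_reprK bourne_pi_scale scale1r. Qed.
Fact bourne_scaleDr : right_distributive bourne_scale +%R.
Proof.
move=> a x y; rewrite -[x]bourne_reprK -[y]bourne_reprK.
by rewrite !(bourne_piD, bourne_pi_scale) scalerDr.
Qed.
Fact bourne_scaleDl x : {morph bourne_scale^~ x : a b / a + b}.
Proof.
move=> a b; rewrite -[x]bourne_reprK !bourne_pi_scale scalerDl.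
by rewrite bourne_piD.
Qed.

HB.instance Definition _ := GRing.Nmodule_isLSemiModule.Build S bourne_quot
  bourne_scaleA bourne_scale0 bourne_scale1 bourne_scaleDr bourne_scaleDl.

End BourneQuotient.

Section SemiringNotions.
Context (S : pzSemiRingType).

(* V(S) *)
Definition neg_part : {pred S^o} :=
  fun s : S^o => `[< exists s' : S^o, s + s' = 0 >].

Fact neg_part_closed : subsemimod_closed neg_part.
Proof.
split; first split.
- by apply/asboolP; exists 0; rewrite addr0.
- move=> x y /asboolP[x' xx'] /asboolP[y' yy'].
  by apply/asboolP; exists (x' + y'); rewrite addrACA xx' yy' addr0.
- move=> a x /asboolP[x' xx'].
  by apply/asboolP; exists (a *: x'); rewrite -scalerDr xx' scaler0.
Qed.

HB.instance Definition _ :=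
  GRing.isSubSemiModClosed.Build S S^o neg_part neg_part_closed.

(* S / V(S) *)
Definition quot_neg_part : lSemiModType S := bourne_quot neg_part.

Definition is_ring : Prop := forall s : S, exists s' : S, s + s' = 0.

(* The left ideals of a ring are the subsemimodules of its regular left
   semimodule [S^o]: closure under opposites follows, as - s = (- 1) s. *)
Definition left_ideals_acc : Prop :=
  forall J : nat -> submodClosed S^o,
    (forall n, {subset J n <= J n.+1}) ->
    exists N, forall n, (N <= n)%N -> J n =i J N.

Definition left_noetherian_ring : Prop := is_ring /\ left_ideals_acc.

End SemiringNotions.

Definition embeds (S : pzSemiRingType) (A B : lSemiModType S) : Prop :=
  exists f : {linear A -> B}, injective f.

(* Main.v *)
(* An e-injective M extends maps along injections with subtractive image.
   Suppose T = S/V(S), which is zerosumfree, embeds in an e-injective E and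
   E^(N) is e-injective. The coproduct T^(N) embeds subtractively in a
   semimodule with an element x absorbing the copies of t in T in every
   coordinate: x + t_n = x. Extend T^(N) -> E^(N) to h; since h(x) has a zero
   coordinate n, the equation h(x)_n + t = h(x)_n gives t = 0. Thus T = 0 and S
   is a ring. Over a ring e-injectivity is Baer's condition, so that Bass's
   theorem remains: if S is Noetherian, the supports of the values of a map from
   a left ideal to a direct sum lie in a finite set; conversely, given left
   ideals J_0 <= J_1 <= ... with union J, the injective module Hom_Z(S, Q/Z)
   contains z_n killed by J_n but not by J (unless J = J_n), and the map
   s |-> (s z_n)_n from J to the direct sum extends to S, whence J = J_n for
   some n. *)
From HB Require Import structures.
Require Import Defs.
From mathcomp Require Import all_boot all_algebra.
From mathcomp Require Import generic_quotient boolp classical_sets cardinality.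

Set Implicit Arguments.
Unset Strict Implicit.
Unset Printing Implicit Defensive.

Import GRing.Theory.
Local Open Scope ring_scope.
Local Open Scope quotient_scope.

(** * Subsemimodules and submonoids as objects *)

Section Subobjects.
Context (S : pzSemiRingType).
Implicit Types A B M : lSemiModType S.

Definition linear_of A B (f : A -> B) (fl : semilinear f) : {linear A -> B} :=
  HB.pack_for {linear A -> B} f (GRing.isSemilinear.Build S A B *:%R f fl).

Definition is_subsemimod M (P : M -> Prop) : Prop :=
  [/\ P 0, forall x y, P x -> P y -> P (x + y) & forall a x, P x -> P (a *: x)].

Definition pred_of_subsemimod M (P : M -> Prop) (_ : is_subsemimod P) :
  {pred M} := fun x => `[< P x >].

Fact pred_of_subsemimod_closed M (P : M -> Prop) (hP : is_subsemimod P) :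
  subsemimod_closed (pred_of_subsemimod hP).
Proof.
case: (hP) => P0 PD PZ; split; first split.
- exact/asboolP.
- by move=> x y /asboolP Px /asboolP Py; apply/asboolP/PD.
- by move=> a x /asboolP Px; apply/asboolP/PZ.
Qed.

Definition submod_of M (P : M -> Prop) (hP : is_subsemimod P) : submodClosed M :=
  HB.pack_for (submodClosed M) (pred_of_subsemimod hP)
    (GRing.isSubSemiModClosed.Build S M (pred_of_subsemimod hP)
       (pred_of_subsemimod_closed hP)).

Lemma submod_ofP M (P : M -> Prop) (hP : is_subsemimod P) x :
  reflect (P x) (x \in submod_of hP).
Proof. exact: asboolP. Qed.

Definition subsemimod M (K : submodClosed M) : Type := {x : M | x \in K}.
HB.instance Definition _ M (K : submodClosed M) := SubChoice.on (subsemimod K).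
HB.instance Definition _ M (K : submodClosed M) :=
  [SubChoice_isSubLSemiModule of subsemimod K by <:].

End Subobjects.

Definition submonoid (C : nmodType) (K : addrClosed C) : Type := {c : C | c \in K}.
HB.instance Definition _ (C : nmodType) (K : addrClosed C) :=
  SubChoice.on (submonoid K).
HB.instance Definition _ (C : nmodType) (K : addrClosed C) :=
  GRing.SubChoice_isSubNmodule.Build C _ (submonoid K) (@Algebra.rpred0D _ K).

(** * Surjectivity of cokernels of commutative monoids *)

Section MonoidCokernel.
Context (A B C : nmodType) (f : {additive A -> B}) (g : {additive B -> C}).

Definition monoid_image : {pred C} := fun c => `[< exists b, g b = c >].

Fact monoid_image_closed : Algebra.nmod_closed monoid_image.
Proof.
split=> [|x y /asboolP[b <-] /asboolP[b' <-]]; apply/asboolP.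
  by exists 0; rewrite raddf0.
by exists (b + b'); rewrite raddfD.
Qed.

HB.instance Definition _ :=
  GRing.isAddClosed.Build C monoid_image monoid_image_closed.

(** The corestriction of [g] to its image factors through [g] by some [k]. The inclusion after [k]
    fixes [g], hence is the identity by uniqueness, so the image is all of [C]. *)
Lemma monoid_cokernel_surj : is_monoid_cokernel f g -> forall c, exists b, g b = c.
Proof.
case=> gf gU.
have img b : g b \in monoid_image by apply/asboolP; exists b.
pose corestr b : submonoid monoid_image := exist _ (g b) (img b).
have corestrD : nmod_morphism corestr.
  by split=> [|x y]; apply: val_inj; rewrite /= ?raddf0 ?raddfD.
pose h : {additive B -> submonoid monoid_image} :=
  HB.pack_for {additive B -> submonoid monoid_image} corestr
    (GRing.isNmodMorphism.Build _ _ corestr corestrD).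
have h0 a : h (f a) = 0 by apply: val_inj; rewrite /= gf.
have [k [kg _]] := gU _ h h0.
have [e [_ eU]] := gU _ g gf.
have valkg : (val \o k) \o g =1 g by move=> b /=; have /= -> := kg b.
have : (val \o k : {additive C -> C}) = (idfun : {additive C -> C}).
  by rewrite -(eU (val \o k) valkg) -(eU idfun).
move=> /(congr1 (fun u : {additive C -> C} => u _)) /= valk c.
by rewrite -(valk c); have /asboolP := valP (k c).
Qed.
End MonoidCokernel.

(** * Extension of homomorphisms along subtractive injections *)

Section Extension.
Context (S : pzSemiRingType).
Implicit Types A B C M X : lSemiModType S.

Fact image_subsemimod A B (f : {linear A -> B}) :
  is_subsemimod (fun b => exists a, f a = b).
Proof.
split=> [|_ _ [a <-] [a' <-]|s _ [a <-]]; first by exists 0; rewrite raddf0.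
  by exists (a + a'); rewrite raddfD.
by exists (s *: a); rewrite linearZ_LR.
Qed.

Fact bourne_pi_semilinear M (L : submodClosed M) : semilinear (@bourne_pi S M L).
Proof.
split=> [s x|x y]; last by rewrite bourne_piD.
exact/esym/bourne_pi_scale.
Qed.

Definition bourne_proj M (L : submodClosed M) : {linear M -> bourne_quot L} :=
  linear_of (bourne_pi_semilinear L).

Lemma bourne_proj_eq M (L : submodClosed M) x y :
  bourne_proj L x = bourne_proj L y <->
  exists l l', [/\ l \in L, l' \in L & x + l = y + l'].
Proof. exact: bourne_piP. Qed.

Lemma bourne_proj_surj M (L : submodClosed M) z : exists x, bourne_proj L x = z.
Proof. by exists (repr z); apply: bourne_reprK. Qed.

Lemma linear_lift A B X (f : {linear A -> B}) (h : {linear X -> B}) :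
  injective f -> (forall x, exists a, f a = h x) ->
  exists k : {linear X -> A}, forall x, f (k x) = h x.
Proof.
move=> f_inj hf; pose k x := projT1 (cid (hf x)).
have kE x : f (k x) = h x := projT2 (cid (hf x)).
have kl : semilinear k.
  split=> [s x|x y]; apply: f_inj; first by rewrite linearZ_LR !kE linearZ_LR.
  by rewrite linearD !kE linearD.
by exists (linear_of kl).
Qed.

Lemma linear_factor B C X (g : {linear B -> C}) (h : {linear B -> X}) :
  (forall c, exists b, g b = c) -> (forall b b', g b = g b' -> h b = h b') ->
  exists k : {linear C -> X}, forall b, k (g b) = h b.
Proof.
move=> g_surj hg; pose r c := projT1 (cid (g_surj c)).
have rK c : g (r c) = c := projT2 (cid (g_surj c)).
pose k c := h (r c); have kE b : k (g b) = h b by apply: hg; rewrite rK.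
have kl : semilinear k.
  split=> [s x|x y]; first by rewrite -[x]rK -linearZ_LR !kE linearZ_LR.
  by rewrite -[x]rK -[y]rK -linearD !kE linearD.
by exists (linear_of kl).
Qed.

(** Subtractivity makes the Bourne class of 0 exactly the image of [f], whence the kernel property.
    A map killing the image agrees on congruent elements, whence the cokernel property. *)
Lemma subtractive_short_exact A B (f : {linear A -> B}) :
  injective f ->
  (forall a a' b, f a + b = f a' -> exists a'', f a'' = b) ->
  short_exact f (bourne_proj (submod_of (image_subsemimod f))).
Proof.
move=> f_inj f_sub; set L := submod_of _; set g := bourne_proj L.
have gf a : g (f a) = 0.
  rewrite -(linear0 g); apply/bourne_proj_eq; exists 0, (f a).
  by split; [exact: rpred0|apply/submod_ofP; exists a|rewrite addr0 add0r].
split; split=> // X h.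
  move=> gh; have [x|k kE] := @linear_lift _ _ _ f h f_inj.
    move: (gh x); rewrite -(linear0 g) => /bourne_proj_eq.
    move=> [l [l' [/submod_ofP[a <-] /submod_ofP[a' <-]]]].
    by rewrite add0r addrC; apply: f_sub.
  exists k; split=> [//|k' k'E]; apply: homS_ext => x; apply: f_inj.
  by rewrite kE; apply/esym/k'E.
move=> hf; have [] := @linear_factor _ _ _ g h (@bourne_proj_surj _ L).
  move=> b b' /bourne_proj_eq[l [l' [/submod_ofP[a <-] /submod_ofP[a' <-]]]].
  by move/(congr1 h); rewrite !linearD !hf !addr0.
move=> k kE; exists k; split=> [//|k' k'E]; apply: homS_ext => c.
have [b <-] := bourne_proj_surj c.
by rewrite [LHS]kE; apply/esym/k'E.
Qed.

(** With its Bourne quotient [f] forms a short exact sequence, so restriction along [f] is a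
    cokernel of monoids and therefore surjective. *)
Lemma e_injective_extend A B M (f : {linear A -> B}) :
  e_injective M -> injective f ->
  (forall a a' b, f a + b = f a' -> exists a'', f a'' = b) ->
  forall phi : {linear A -> M},
    exists psi : {linear B -> M}, forall a, psi (f a) = phi a.
Proof.
move=> eM f_inj f_sub phi.
have [_ coker] := eM _ _ _ _ _ (subtractive_short_exact f_inj f_sub).
have [psi psiE] := monoid_cokernel_surj coker (phi : homS A M).
by exists psi => a; rewrite -psiE.
Qed.

Fact scale_by_semilinear M (m : M) :
  @GRing.semilinear_for S S^o M *:%R (fun s : S => s *: m).
Proof. by split=> [s t|s t]; rewrite ?scalerDl // -scalerA. Qed.

Definition scale_by M (m : M) : {linear S^o -> M} :=
  linear_of (scale_by_semilinear m).

(** Elements of [A] are maps [S^o -> A]. Those given by [a] and [a'] have the same composite with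
    [f], and factorizations through a kernel are unique. *)
Lemma kernel_inj A B C (f : {linear A -> B}) (g : {linear B -> C}) :
  is_kernel f g -> injective f.
Proof.
move=> [gf fU] a a' faa'.
have /fU[k [_ kU]] s : g ((f \o scale_by a) s) = 0 by apply: gf.
have E u (fu : f u = f a) : k = scale_by u.
  by apply: kU => s /=; rewrite !linearZ_LR fu.
have := E a' (esym faa'); rewrite (E a erefl).
move/(congr1 (fun u : {linear S^o -> A} => u 1)) => /=.
by rewrite !scale1r.
Qed.

End Extension.

(** * Baer's criterion over a ring *)

Section Baer.
Context (S : pzSemiRingType).
Implicit Types A B C M D : lSemiModType S.

(* Homomorphisms on submodules are handled as their graphs. *)
Definition functional A D (G : A * D -> Prop) : Prop :=
  forall y, G (0, y) -> y = 0.

(** Over a ring, [G] is the graph of a homomorphism on a left ideal, and s |-> s m extends it to all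
    of [S]. *)
Definition baer D : Prop :=
  forall G : S^o * D -> Prop, is_subsemimod G -> functional G ->
    exists m, forall (s : S) y, G (s, y) -> y = s *: m.

(** An element [n1] in the role of -1 provides subtraction in every semimodule, while the type [S]
    remains a mere semiring. *)
Context (n1 : S) (n1P : 1 + n1 = 0).

Lemma addrN1 M (x : M) : x + n1 *: x = 0.
Proof. by rewrite -{1}[x]scale1r -scalerDl n1P scale0r. Qed.

Lemma ring_addIr M (x y z : M) : x + z = y + z -> x = y.
Proof. by move/(congr1 (+%R^~ (n1 *: z))); rewrite -!addrA !addrN1 !addr0. Qed.

Lemma functional_uniq A D (G : A * D -> Prop) a y y' :
  is_subsemimod G -> functional G -> G (a, y) -> G (a, y') -> y = y'.
Proof.
move=> [_ GD GZ] G0 Gy Gy'; apply: (@ring_addIr _ _ _ (n1 *: y')).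
rewrite addrN1; apply: G0; rewrite -(addrN1 a).
by apply: (GD (_, _) (_, _)) => //; apply: (GZ _ (_, _)) Gy'.
Qed.

Local Open Scope classical_set_scope.

(** Zorn's lemma gives a maximal functional graph containing [G]. It is total, since Baer's
    condition allows any [b] to be adjoined to its domain. *)
Lemma baer_extend B D (G : B * D -> Prop) :
  baer D -> is_subsemimod G -> functional G ->
  exists psi : {linear B -> D}, forall b y, G (b, y) -> psi b = y.
Proof.
move=> baerD subG funG.
(* The union with G keeps the empty chain harmless in Zorn_bigcup. *)
pose Q (X : set (B * D)) :=
  is_subsemimod (fun u => G u \/ X u) /\ functional (fun u => G u \/ X u).
have [F FQ Ftot|H [[subH funH] maxH]] := @Zorn_bigcup _ Q.
  have [G0 GD GZ] := subG; split; first split.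
  - by left.
  - have key X u v : F X -> G u \/ X u -> G v \/ X v ->
        G (u + v) \/ (\bigcup_(Y in F) Y) (u + v).
      move=> FX Xu Xv; have [[_ XD _] _] := FQ _ FX.
      by have [Guv|Xuv] := XD _ _ Xu Xv; [left|right; exists X].
    move=> u v [Gu|[X FX Xu]] [Gv|[Y FY Yv]].
    + by left; apply: GD.
    + by apply: key FY _ _; [left|right].
    + by apply: key FX _ _; [right|left].
    + have [XY|YX] := Ftot _ _ FX FY.
        by apply: key FY _ _; right=> //; apply: XY.
      by apply: key FX _ _; right=> //; apply: YX.
  - move=> s u [Gu|[X FX Xu]]; first by left; apply: GZ.
    have [[_ _ XZ] _] := FQ _ FX.
    by have [] := XZ s u (or_intror Xu); [left|right; exists X].
  - move=> y [|[X FX Xy]]; first exact: funG.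
    by have [_ +] := FQ _ FX; apply; right.
pose E (u : B * D) := G u \/ H u.
have {subH} subE : is_subsemimod E by [].
have {funH} funE : functional E by [].
have [E0 ED EZ] := subE.
have total b : exists y, E (b, y).
  (* The graph of s |-> E(s b), on the left ideal of those s for which s b lies in the domain of
     [E]. *)
  pose K (u : S^o * D) := E ((u.1 : S) *: b, u.2).
  have [||m mE] := baerD K.
  - split; rewrite /K /= ?scale0r //.
      by move=> x y Kx Ky; rewrite scalerDl; apply: (ED (_, _) (_, _)).
    by move=> a x Kx; rewrite -[a *: x.1]/(a * x.1) -scalerA; apply: (EZ _ (_, _)).
  - by move=> y; rewrite /K /= scale0r; apply: funE.
  (* The extension of [E] that sends [b] to [m]. *)
  pose E' (u : B * D) := exists s c y, E (c, y) /\ u = (c + s *: b, y + s *: m).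
  have EE' u : E u -> E' u.
    by case: u => c y Ecy; exists 0, c, y; rewrite !scale0r !addr0.
  have E'm : E' (b, m).
    by exists 1, 0, 0; rewrite !scale1r !add0r.
  suff QE' : Q E'.
    exists m; right; apply: contrapT => Hbm.
    apply: (maxH E') => //; split; last by move/(_ _ E'm).
    by move=> u Hu; apply: EE'; right.
  have -> : Q E' = (is_subsemimod E' /\ functional E').
    have GE' : (fun u => G u \/ E' u) = E'.
      apply/funext => u; apply/propext; split; last by right.
      by case=> // Gu; apply: EE'; left.
    by rewrite /Q GE'.
  split; first split.
  - exact: EE'.
  - move=> _ _ [s [c [y [Ey ->]]]] [t [d [z [Ez ->]]]].
    exists (s + t), (c + d), (y + z); split; first exact: (ED (_, _) (_, _)).
    by congr pair; rewrite /= scalerDl addrACA.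
  - move=> a _ [s [c [y [Ey ->]]]]; exists (a * s), (a *: c), (a *: y).
    split; first exact: (EZ _ (_, _)).
    by congr pair; rewrite /= scalerDr scalerA.
  - move=> _ [s [c [y [Ey [csb ->]]]]].
    (* From c + s b = 0 follows s b = -c, so [K] contains (s, -y) and the choice of [m] gives -y = s
       m. *)
    have Kny : K (s, n1 *: y).
      rewrite /K /=; have -> : s *: b = n1 *: c.
        by apply: (@ring_addIr _ _ _ c); rewrite addrC -csb addrC addrN1.
      exact: (EZ _ (_, _)).
    by rewrite -(mE _ _ Kny) addrN1.
pose psi b := projT1 (cid (total b)).
have psiE b : E (b, psi b) := projT2 (cid (total b)).
have psil : semilinear psi.
  split=> [s x|x y]; apply: functional_uniq subE funE (psiE _) _.
    exact: (EZ _ (_, _)).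
  exact: (ED (_, _) (_, _)).
exists (linear_of psil) => b y Gby.
by apply: functional_uniq subE funE (psiE _) _; left.
Qed.

End Baer.

Lemma additive_ext (U V : nmodType) (h k : {additive U -> V}) : h =1 k -> h = k.
Proof.
case: h => h [[hD]]; case: k => k [[kD]] /= /funext hk.
by subst k; rewrite (Prop_irrelevance kD hD).
Qed.

(** * Over a ring, e-injectivity is Baer's condition *)

Section EInjectiveBaer.
Context (S : pzSemiRingType) (n1 : S) (n1P : 1 + n1 = 0).
Implicit Types A B C M D : lSemiModType S.

Fact diff_semilinear A D (h k : {linear A -> D}) :
  semilinear (fun x => h x + n1 *: k x).
Proof.
split=> [s x|x y]; last by rewrite !linearD scalerDr addrACA.
rewrite !linearZ_LR scalerDr !scalerA; congr (_ + _ *: _).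
(* The element [n1] is central, as both products with s are opposites of s. *)
apply: (@ring_addIr _ _ n1P S^o _ _ s); rewrite -{2}[s]mul1r -{4}[s]mulr1.
by rewrite -mulrDl -mulrDr addrC n1P mul0r mulr0.
Qed.

(** The first projection of [G] to [S^o] is injective because [G] is functional, and its image is
    subtractive because subtraction is available. The second projection then extends to [S^o], and
    its value at 1 is the required element. *)
Lemma e_injective_baer M : e_injective M -> baer M.
Proof.
move=> eM G subG funG; pose K := submod_of subG.
pose f : {linear subsemimod K -> S^o} := fst \o (val : subsemimod K -> _).
pose phi : {linear subsemimod K -> M} := snd \o (val : subsemimod K -> _).
have KG (a : subsemimod K) : G (val a) by apply/(submod_ofP subG)/(valP a).
have f_inj : injective f.
  move=> a a' faa'; apply: val_inj; move: faa' (KG a) (KG a') => /=.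
  case: (val a) (val a') => [s y] [s' y'] /= -> Gy Gy'; congr pair.
  exact: (functional_uniq n1P subG funG Gy).
have f_sub a a' b : f a + b = f a' -> exists a'', f a'' = b.
  move=> e; exists (a' + n1 *: a).
  by rewrite linearD linearZ_LR -e addrAC (addrN1 n1P) add0r.
have [psi psiE] := e_injective_extend eM f_inj f_sub phi.
exists (psi 1) => s y Gsy.
have Ksy : (s, y) \in K by apply/(submod_ofP subG).
have := psiE (exist _ (s, y) Ksy); rewrite /= => <-.
by rewrite -linearZ_LR; congr (psi _); apply/esym/mulr1.
Qed.

(** [baer_extend] makes restriction along [f] surjective; the universal property of [g] makes
    restriction along [g] the kernel of that map. *)
Lemma baer_e_injective D : baer D -> e_injective D.
Proof.
move=> baerD A B C f g [kerf [gf gU]].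
have f_inj := kernel_inj kerf.
have ext (phi : homS A D) : exists psi : homS B D, hom_pre D f psi = phi.
  pose G (u : B * D) := exists a, u = (f a, phi a).
  have subG : is_subsemimod G.
    split; first by exists 0; rewrite !linear0.
      by move=> _ _ [a ->] [b ->]; exists (a + b); rewrite !linearD.
    by move=> s _ [a ->]; exists (s *: a); rewrite !linearZ_LR.
  have funG : functional G.
    move=> y [a [/esym fa0 ->]]; rewrite (_ : a = 0) ?linear0 //.
    by apply: f_inj; rewrite linear0.
  have [psi psiE] := baer_extend n1P baerD subG funG.
  by exists psi; apply: homS_ext => a; apply: psiE; exists a.
have gext (h : homS B D) : (forall a, h (f a) = 0) ->
    exists k : homS C D, hom_pre D g k = h.
  by move=> hf; have [k [kg _]] := gU _ h hf; exists k; apply: homS_ext.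
have gpre_inj : injective (hom_pre D g).
  move=> k k' kk'; have kg0 a : hom_pre D g k (f a) = 0 by rewrite /= gf linear0.
  have [l [_ lU]] := gU _ (hom_pre D g k) kg0.
  by rewrite -(lU k) // -(lU k') // kk'.
split; split.
- by move=> k; apply: homS_ext => a /=; rewrite gf linear0.
- move=> X h hf.
  have hg x : exists k, hom_pre D g k = h x.
    apply: gext => a.
    exact: (congr1 (fun u : {linear A -> D} => u a) (hf x)).
  pose k x := projT1 (cid (hg x)).
  have kE x : hom_pre D g (k x) = h x := projT2 (cid (hg x)).
  have kD : nmod_morphism k.
    split=> [|x y]; apply: gpre_inj; first by rewrite kE !raddf0.
    by rewrite kE raddfD -!kE; apply/esym/(raddfD (hom_pre D g)).
  pose ka : {additive X -> homS C D} :=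
    HB.pack_for {additive X -> homS C D} k (GRing.isNmodMorphism.Build _ _ k kD).
  exists ka; split=> // k' k'E; apply: additive_ext => x; apply: gpre_inj.
  by rewrite kE; apply/esym/k'E.
- by move=> k; apply: homS_ext => a /=; rewrite gf linear0.
- move=> X h hg.
  (* Two extensions of the same map differ by a map vanishing on the image of [f]. It comes from
     [C], so [h] kills it. *)
  have hE psi psi' : hom_pre D f psi = hom_pre D f psi' -> h psi = h psi'.
    move=> e; pose d : homS B D := linear_of (diff_semilinear psi psi').
    have [k kd] : exists k, hom_pre D g k = d.
      apply: gext => a; have := congr1 (fun u : {linear A -> D} => u a) e.
      by rewrite /= => ->; rewrite (addrN1 n1P).
    have -> : psi = psi' + d.
      apply: homS_ext => x /=.
      by rewrite addrCA (addrN1 n1P) addr0.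
    by rewrite raddfD -kd hg addr0.
  pose k phi := h (projT1 (cid (ext phi))).
  have kE psi : k (hom_pre D f psi) = h psi.
    by apply: hE; apply: (projT2 (cid (ext (hom_pre D f psi)))).
  have kD : nmod_morphism k.
    split=> [|x y]; first by rewrite -(raddf0 (hom_pre D f)) kE raddf0.
    have [[x' <-] [y' <-]] := (ext x, ext y).
    by rewrite -raddfD !kE raddfD.
  pose ka : {additive homS A D -> X} :=
    HB.pack_for {additive homS A D -> X} k (GRing.isNmodMorphism.Build _ _ k kD).
  exists ka; split=> [x|k' k'E]; first exact: kE.
  apply: additive_ext => phi; have [psi <-] := ext phi.
  by rewrite [LHS]kE; apply/esym/k'E.
Qed.

End EInjectiveBaer.

(** * Direct sums over a left Noetherian ring *)

Section NoetherianDirectSum.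
Context (S : pzSemiRingType) (n1 : S) (n1P : 1 + n1 = 0).
Context (I : Type) (M : I -> lSemiModType S).

Local Open Scope classical_set_scope.

Definition supp (y : dsum M) : set I := [set i | y i <> 0].

(** Otherwise pairs of [G] can be picked whose supports repeatedly leave the finite set reached so
    far. The elements whose values are supported in the n-th set form an ascending chain of left
    ideals; where it is stationary, uniqueness of values contradicts the next pick. *)
Lemma supp_bounded (G : S^o * dsum M -> Prop) :
  left_ideals_acc S -> is_subsemimod G -> functional G ->
  exists2 F : set I, finite_set F & forall s y, G (s, y) -> supp y `<=` F.
Proof.
move=> acc subG funG; apply: contrapT => noF.
(* Nothing is asked of the pair at an infinite [F], so the choice is possible at every set. *)
have [F|pick pickP] := @choice (set I) (S^o * dsum M)%type
    (fun F u => finite_set F -> G u /\ ~ supp u.2 `<=` F).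
  apply: contrapT => /forallNP noU; apply: noF; exists F.
    by apply: contrapT => infF; apply: (noU 0) => /infF.
  move=> s y Gsy; apply: contrapT => yF; apply: (noU (s, y)) => _; by split.
pose Fs n := iter n (fun F => F `|` supp (pick F).2) set0.
have finFs n : finite_set (Fs n).
  by elim: n => //= n IHn; rewrite finite_setU; split=> //; apply: dsum_finite.
pose P n (s : S^o) := exists2 y, G (s, y) & supp y `<=` Fs n.
have subP n : is_subsemimod (P n).
  have [G0 GD GZ] := subG; split; first by exists 0 => // i /=.
    move=> s t [y Gsy yF] [z Gtz zF]; exists (y + z).
      exact: (GD (_, _) (_, _)).
    move=> i /= yz0; have [y0|] := pselect (y i = 0); last exact: yF.
    by apply: zF => z0; apply: yz0; rewrite /= y0 z0 addr0.
  move=> a s [y Gsy yF]; exists (a *: y); first exact: (GZ _ (_, _)).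
  by move=> i /= ay0; apply: yF => y0; apply: ay0; rewrite /= y0 scaler0.
have [n s /(submod_ofP (subP n))[y Gsy yF]|N accN] :=
    acc (fun n => submod_of (subP n)).
  by apply/(submod_ofP (subP n.+1)); exists y => //; apply: subset_trans yF _; left.
have [Gu uN] := pickP _ (finFs N).
have : (pick (Fs N)).1 \in submod_of (subP N.+1).
  apply/(submod_ofP (subP N.+1)); exists (pick (Fs N)).2.
    by case: (pick (Fs N)) Gu.
  by right.
rewrite accN // => /(submod_ofP (subP N))[y Gy yF]; apply: uN.
have -> // : (pick (Fs N)).2 = y.
by apply: (functional_uniq n1P subG funG _ Gy); case: (pick (Fs N)) Gu.
Qed.

Lemma dsum_baer :
  left_ideals_acc S -> (forall i, baer (M i)) -> baer (dsum M).
Proof.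
move=> acc baerM G subG funG; have [F finF FG] := supp_bounded acc subG funG.
have [G0 GD GZ] := subG.
have coord i : exists m : M i, forall (s : S) y, G (s, y) -> y i = s *: m.
  pose Gi (u : S^o * M i) := exists2 y, G (u.1, y) & u.2 = y i.
  have [||m mE] := baerM i Gi.
  - split; first by exists 0.
      move=> u v [y Gy yE] [z Gz zE]; exists (y + z); last by rewrite /= yE zE.
      exact: (GD (_, _) (_, _)).
    move=> a u [y Gy yE]; exists (a *: y); last by rewrite /= yE.
    exact: (GZ _ (_, _)).
  - by move=> z [y /= /funG -> ->].
  - by exists m => s y Gsy; apply: mE; exists y.
(* Baer's condition in each coordinate need not give finite support; outside [F], where all values
   vanish, 0 serves. *)
pose m i := if pselect (F i) is left _ then projT1 (cid (coord i)) else 0.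
have finm : finite_set [set i | m i <> 0].
  by apply: sub_finite_set finF => i /=; rewrite /m; case: pselect.
exists (DSum finm) => s y Gsy; apply: dsum_ext => i /=.
rewrite /m; case: pselect => [Fi|nFi]; first exact: (projT2 (cid (coord i))).
by rewrite scaler0; apply: contrapT => yi; apply/nFi/(FG s y Gsy).
Qed.

End NoetherianDirectSum.

Lemma noetherian_dsum (S : pzSemiRingType) (I : Type) (M : I -> lSemiModType S) :
  left_noetherian_ring S -> (forall i, e_injective (M i)) -> e_injective (dsum M).
Proof.
move=> [/(_ 1)[n1 n1P] acc] eM; apply: (baer_e_injective n1P).
by apply: (dsum_baer n1P acc) => i; apply: (e_injective_baer n1P).
Qed.

(** Over a ring V(S) = S, so the quotient is zero and embeds in the empty direct sum. *)
Lemma noetherian_quot_neg_part_embeds (S : pzSemiRingType) :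
  left_noetherian_ring S ->
  exists E : lSemiModType S, e_injective E /\ embeds (quot_neg_part S) E.
Proof.
move=> noeth; pose M (i : False) : lSemiModType S := S^o.
exists (dsum M); split; first by apply: (noetherian_dsum noeth); case.
have zl : semilinear (fun _ : quot_neg_part S => 0 : dsum M).
  by split=> [s x|x y]; rewrite ?scaler0 ?addr0.
exists (linear_of zl) => x y _.
have [[a <-] [b <-]] := (bourne_proj_surj x, bourne_proj_surj y).
apply/bourne_proj_eq; exists b, a; rewrite addrC; split=> //.
  by apply/asboolP; apply: noeth.1.
by apply/asboolP; apply: noeth.1.
Qed.

(** * Quotients of semimodules by congruences *)

Section CongruenceQuotient.
Context (S : pzSemiRingType) (M : lSemiModType S).

Record congruence : Type := Congruence {
  congr_rel :> M -> M -> Prop;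
  congr_refl : forall x, congr_rel x x;
  congr_sym : forall x y, congr_rel x y -> congr_rel y x;
  congr_trans : forall y x z, congr_rel x y -> congr_rel y z -> congr_rel x z;
  congr_add : forall x y x' y',
    congr_rel x x' -> congr_rel y y' -> congr_rel (x + y) (x' + y');
  congr_scale : forall s x x', congr_rel x x' -> congr_rel (s *: x) (s *: x')
}.

Context (R : congruence).

Fact congr_rel_refl : reflexive (fun x y => `[< R x y >]).
Proof. by move=> x; apply/asboolP/congr_refl. Qed.
Fact congr_rel_sym : symmetric (fun x y => `[< R x y >]).
Proof. by move=> x y; apply: asbool_equiv_eq; split; apply: congr_sym. Qed.
Fact congr_rel_trans : transitive (fun x y => `[< R x y >]).
Proof.
by move=> y x z /asboolP xy /asboolP yz; apply/asboolP; apply: congr_trans xy yz.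
Qed.

Definition congr_equiv : equiv_rel M :=
  EquivRel (fun x y => `[< R x y >]) congr_rel_refl congr_rel_sym congr_rel_trans.

Definition congr_quot : Type := {eq_quot congr_equiv}.
HB.instance Definition _ := Choice.on congr_quot.
HB.instance Definition _ := EqQuotient.on congr_quot.

Definition congr_pi (x : M) : congr_quot := \pi_congr_quot x.

Lemma congr_piP x y : congr_pi x = congr_pi y <-> R x y.
Proof. by split=> [/eqmodP/asboolP|h]; [|apply/eqmodP/asboolP]. Qed.

Lemma congr_reprK (q : congr_quot) : congr_pi (repr q) = q.
Proof. exact: reprK. Qed.

Lemma congr_repr_pi x : R (repr (congr_pi x)) x.
Proof. by apply/congr_piP; apply: congr_reprK. Qed.

Definition congr_quot_add (p q : congr_quot) := congr_pi (repr p + repr q).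
Definition congr_quot_scale s (q : congr_quot) := congr_pi (s *: repr q).

Lemma congr_pi_add x y :
  congr_quot_add (congr_pi x) (congr_pi y) = congr_pi (x + y).
Proof. by apply/congr_piP; apply: congr_add; apply: congr_repr_pi. Qed.

Lemma congr_pi_scale s x : congr_quot_scale s (congr_pi x) = congr_pi (s *: x).
Proof. by apply/congr_piP; apply: congr_scale; apply: congr_repr_pi. Qed.

Fact congr_addA : associative congr_quot_add.
Proof.
move=> x y z; rewrite -[x]congr_reprK -[y]congr_reprK -[z]congr_reprK.
by rewrite !congr_pi_add addrA.
Qed.
Fact congr_addC : commutative congr_quot_add.
Proof. by move=> x y; rewrite /congr_quot_add addrC. Qed.
Fact congr_add0 : left_id (congr_pi 0) congr_quot_add.
Proof. by move=> x; rewrite -[x]congr_reprK congr_pi_add add0r. Qed.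

HB.instance Definition _ :=
  GRing.isNmodule.Build congr_quot congr_addA congr_addC congr_add0.

Lemma congr_piD x y : congr_pi x + congr_pi y = congr_pi (x + y).
Proof. exact: congr_pi_add. Qed.

Fact congr_scaleA a b x :
  congr_quot_scale a (congr_quot_scale b x) = congr_quot_scale (a * b) x.
Proof. by rewrite -[x]congr_reprK !congr_pi_scale scalerA. Qed.
Fact congr_scale0 x : congr_quot_scale 0 x = 0.
Proof. by rewrite -[x]congr_reprK congr_pi_scale scale0r. Qed.
Fact congr_scale1 : left_id 1 congr_quot_scale.
Proof. by move=> x; rewrite -[x]congr_reprK congr_pi_scale scale1r. Qed.
Fact congr_scaleDr : right_distributive congr_quot_scale +%R.
Proof.
move=> a x y; rewrite -[x]congr_reprK -[y]congr_reprK.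
by rewrite !(congr_piD, congr_pi_scale) scalerDr.
Qed.
Fact congr_scaleDl x : {morph congr_quot_scale^~ x : a b / a + b}.
Proof.
move=> a b; rewrite -[x]congr_reprK !congr_pi_scale scalerDl.
by rewrite congr_piD.
Qed.

HB.instance Definition _ := GRing.Nmodule_isLSemiModule.Build S congr_quot
  congr_scaleA congr_scale0 congr_scale1 congr_scaleDr congr_scaleDl.

Fact congr_pi_semilinear : semilinear congr_pi.
Proof. by split=> [s x|x y]; [apply/esym/congr_pi_scale|rewrite congr_piD]. Qed.

Definition congr_proj : {linear M -> congr_quot} := linear_of congr_pi_semilinear.

Lemma congr_proj_eq x y : congr_proj x = congr_proj y <-> R x y.
Proof. exact: congr_piP. Qed.

End CongruenceQuotient.

(** * The absorbing extension of a zerosumfree semimodule *)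

Section Absorption.
Context (S : pzSemiRingType) (T : lSemiModType S).
Hypothesis T_zsf : forall t u : T, t + u = 0 -> t = 0.

Local Open Scope classical_set_scope.

Let TN := dsum (fun _ : nat => T).

(* [s] can absorb [t]: the multiples [k] make this additive in [t]. *)
Definition below (s t : T) : Prop := exists u k, t + u = s *+ k.

Lemma below0 s : below s 0.
Proof. by exists 0, 0; rewrite addr0. Qed.

Lemma below_refl s : below s s.
Proof. by exists 0, 1; rewrite addr0. Qed.

Lemma belowD s t t' : below s t -> below s t' -> below s (t + t').
Proof.
move=> [u [k e]] [u' [k' e']]; exists (u + u'), (k + k')%N.
by rewrite addrACA e e' mulrnDr.
Qed.

(** Whatever one summand absorbs, the sum absorbs; hence [absorb] respects addition. *)
Lemma below_addr s s' t : below s t -> below (s + s') t.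
Proof.
by move=> [u [k e]]; exists (u + s' *+ k), k; rewrite addrA e mulrnDl.
Qed.

Lemma below_scale a s t : below s t -> below (a *: s) (a *: t).
Proof.
move=> [u [k e]]; exists (a *: u), k.
rewrite -scalerDr e; elim: k {e} => [|k IHk]; first by rewrite scaler0.
by rewrite !mulrS scalerDr IHk.
Qed.

(* Coordinatewise, modulo summands absorbed by the common second component. *)
Definition absorb (x y : TN * T) : Prop :=
  x.2 = y.2 /\
  forall n, exists a b, [/\ below x.2 a, below x.2 b & x.1 n + a = y.1 n + b].

Fact absorb_refl x : absorb x x.
Proof. by split=> // n; exists 0, 0; split=> //; apply: below0. Qed.

Fact absorb_sym x y : absorb x y -> absorb y x.
Proof.
move=> [e xy]; split=> // n; have [a [b [? ? ?]]] := xy n.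
by exists b, a; rewrite -e.
Qed.

Fact absorb_trans y x z : absorb x y -> absorb y z -> absorb x z.
Proof.
move=> [e xy] [f yz]; split=> [|n]; first by rewrite e.
have [[a [b [xa xb ab]]] [c [d [yc yd cd]]]] := (xy n, yz n).
rewrite -e in yc yd; exists (a + c), (b + d); split; try exact: belowD.
by rewrite addrA ab addrAC cd -!addrA (addrC b).
Qed.

Fact absorb_add x y x' y' : absorb x x' -> absorb y y' -> absorb (x + y) (x' + y').
Proof.
move=> [e xx] [f yy]; split=> [|n] /=; first by rewrite e f.
have [[a [b [xa xb ab]]] [c [d [yc yd cd]]]] := (xx n, yy n).
exists (a + c), (b + d); split; last by rewrite addrACA ab cd addrACA.
  by apply: belowD; [|rewrite addrC]; apply: below_addr.
by apply: belowD; [|rewrite addrC]; apply: below_addr.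
Qed.

Fact absorb_scale s x x' : absorb x x' -> absorb (s *: x) (s *: x').
Proof.
move=> [e xx]; split=> [|n] /=; first by rewrite e.
have [a [b [xa xb ab]]] := xx n; exists (s *: a), (s *: b).
by split; rewrite -?scalerDr ?ab //; apply: below_scale.
Qed.

Definition absorb_congruence : congruence (TN * T)%type :=
  Congruence absorb_refl absorb_sym absorb_trans absorb_add absorb_scale.

Definition delta_fun (n : nat) (t : T) (i : nat) : T := if i == n then t else 0.

Fact delta_finite n t : finite_set [set i | delta_fun n t i <> 0].
Proof.
apply: sub_finite_set (finite_set1 n) => i /=.
by rewrite /delta_fun; case: eqP.
Qed.

Definition delta n t : TN := DSum (delta_finite n t).

Fact absorb_incl_semilinear :
  semilinear (fun l : TN => congr_proj absorb_congruence (l, 0)).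
Proof.
split=> [s l|l l'].
  by rewrite -linearZ_LR; congr congr_pi; congr pair; rewrite /= scaler0.
by rewrite -linearD; congr congr_pi; congr pair; rewrite /= addr0.
Qed.

Definition absorb_incl : {linear TN -> congr_quot absorb_congruence} :=
  linear_of absorb_incl_semilinear.

Lemma below_0 t : below 0 t -> t = 0.
Proof. by case=> u [k]; rewrite mul0rn; apply: T_zsf. Qed.

(** The second component is 0 here, and in a zerosumfree [T] it absorbs only 0. *)
Lemma absorb_incl_inj : injective absorb_incl.
Proof.
move=> l l' /congr_proj_eq[_ ll']; apply: dsum_ext => n.
by have [a [b [/below_0-> /below_0->]]] := ll' n; rewrite !addr0.
Qed.

(** Congruent pairs have equal second components, so that of [b] must be 0. *)
Lemma absorb_incl_subtractive l l' b :
  absorb_incl l + b = absorb_incl l' -> exists l'', absorb_incl l'' = b.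
Proof.
rewrite -[b]congr_reprK; case: (repr b) => m s e.
have : congr_proj absorb_congruence ((l, 0) + (m, s)) = absorb_incl l'.
  by rewrite linearD; apply: e.
by move/congr_proj_eq => [/=]; rewrite add0r => -> _; exists m.
Qed.

Lemma absorb_delta n t :
  congr_proj absorb_congruence (0, t) + absorb_incl (delta n t) =
  congr_proj absorb_congruence (0, t).
Proof.
rewrite -linearD; apply/congr_proj_eq; split=> [|i] /=; first exact: addr0.
rewrite addr0 add0r /delta_fun; exists 0, (if i == n then t else 0).
split; rewrite ?add0r ?addr0 //; first exact: below0.
by case: ifP => _; [apply: below_refl|apply: below0].
Qed.

Lemma zerosumfree_embedding_trivial (E : lSemiModType S) (phi : {linear T -> E}) :
  injective phi -> e_injective (dsum (fun _ : nat => E)) -> forall t : T, t = 0.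
Proof.
move=> phi_inj eE t.
have fin (l : TN) : finite_set [set n | phi (l n) <> 0].
  apply: sub_finite_set (dsum_finite l) => n /= pl l0.
  by apply: pl; rewrite l0 linear0.
pose phiN (l : TN) : dsum (fun _ : nat => E) := DSum (fin l).
have phiNl : semilinear phiN.
  by split=> [s l|l l']; apply: dsum_ext => n /=; rewrite ?linearZ_LR ?linearD.
have [h hE] := e_injective_extend eE absorb_incl_inj absorb_incl_subtractive
  (linear_of phiNl).
pose x := congr_proj absorb_congruence (0, t).
(* The support of [h x] is finite, hence misses some index. *)
have [n hxn] : exists n, h x n = 0.
  apply: contrapT => /forallNP hx; apply: infinite_nat.
  by apply: sub_finite_set (dsum_finite (h x)) => n _; apply: hx.
apply: phi_inj; rewrite linear0.
have := congr1 (fun y => h y n) (absorb_delta n t).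
by rewrite linearD hE /= /delta_fun eqxx hxn add0r.
Qed.

End Absorption.

(** If a + b + l lies in V(S), it has an opposite, and then so does a. *)
Lemma quot_neg_part_zerosumfree (S : pzSemiRingType) (t u : quot_neg_part S) :
  t + u = 0 -> t = 0.
Proof.
have [[a <-] [b <-]] := (bourne_proj_surj t, bourne_proj_surj u).
rewrite -linearD -(linear0 (bourne_proj _)) => /bourne_proj_eq.
move=> [l [l' [_ /asboolP[k' l'k'] e]]].
apply/bourne_proj_eq; exists 0, a; split; last by rewrite addr0 add0r.
  exact: rpred0.
apply/asboolP; exists (b + l + k').
by rewrite addrA addrA e add0r.
Qed.

Lemma embedding_is_ring (S : pzSemiRingType) (E : lSemiModType S) :
  embeds (quot_neg_part S) E -> e_injective (dsum (fun _ : nat => E)) ->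
  is_ring S.
Proof.
move=> [phi phi_inj] eE s.
have := zerosumfree_embedding_trivial (@quot_neg_part_zerosumfree S) phi_inj eE
  (bourne_proj _ (s : S^o)).
rewrite -(linear0 (bourne_proj _)) => /bourne_proj_eq.
move=> [l [l' [_ /asboolP[k' l'k'] e]]]; exists (l + k').
by rewrite addrA [s + l]e add0r.
Qed.

(** * Injectivity of Q/Z over the integers *)

Section DivisibleGroups.
Implicit Types D : lSemiModType int.

(** The generator is the least positive element, if any, and 0 otherwise; remainders modulo it stay
    in [P]. *)
Lemma int_ideal_generator (P : int -> Prop) :
  P 0 -> (forall j k, P j -> P k -> P (j + k)) -> (forall a k, P k -> P (a * k)) ->
  exists2 d : nat, P d%:Z & forall k, P k -> (d%:Z %| k)%Z.
Proof.
move=> P0 PD PM; have [[d0 [d0_gt0 Pd0]]|noP] :=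
    pselect (exists d : nat, (0 < d)%N /\ P d%:Z); last first.
  exists 0%N => // k Pk; rewrite dvd0z; apply: contrapT => /negP k0; apply: noP.
  exists `|k|%N; rewrite absz_gt0; split=> //.
  by rewrite abszEsg; apply: PM.
have exd : exists d, (0 < d)%N && `[< P d%:Z >].
  by exists d0; rewrite d0_gt0; apply/asboolP.
case: (ex_minnP exd) => d /andP[d_gt0 /asboolP Pd] dmin; exists d => // k Pk.
have d_neq0 : d%:Z != 0 by rewrite -lt0n.
have Pr : P (k %% d%:Z)%Z.
  by rewrite /modz addrC -mulNr; apply: PD => //; apply: PM.
have r_lt := ltz_mod k d_neq0.
have r_ge := modz_ge0 k d_neq0.
apply/dvdz_mod0P; case: (k %% d)%Z r_ge r_lt Pr => // r _ r_lt Pr.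
case: r r_lt Pr => // r r_lt Pr; exfalso.
have := dmin r.+1; rewrite /= => /(_ (asboolT Pr)).
by rewrite leqNgt => /negP; apply.
Qed.

Lemma divisible_baer D :
  (forall (y : D) (d : int), d != 0 -> exists m, y = d *: m) -> baer D.
Proof.
move=> divD G subG funG; have [G0 GD GZ] := subG.
pose P k := exists y, G (k, y).
have [|||d [y Gdy] dP] := @int_ideal_generator P.
- by exists 0.
- by move=> j k [y Gy] [z Gz]; exists (y + z); apply: (GD (_, _) (_, _)).
- by move=> a k [y Gy]; exists (a *: y); apply: (GZ _ (_, _)).
(* The value at the generator d is divided by d; if d = 0 that value is 0. *)
have [m ym] : exists m, y = d%:Z *: m.
  have [d0|] := eqVneq d%:Z 0; last exact: divD.
  by exists 0; rewrite scaler0; apply: funG; rewrite -d0.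
exists m => k z Gkz; have /dvdzP[q kq] := dP k (ex_intro _ z Gkz).
have := GZ q _ Gdy; rewrite /= -[q *: _]/(q * _, q *: y) -kq => Gq.
rewrite (functional_uniq (n1 := -1) _ subG funG Gkz Gq) // ym.
by rewrite scalerA -kq.
Qed.

Fact rat_int_subsemimod :
  is_subsemimod (fun r : zmodule rat => exists k : int, r = k%:~R :> rat).
Proof.
split=> [|_ _ [j ->] [k ->]|a _ [k ->]]; first by exists 0.
  by exists (j + k); rewrite rmorphD.
by exists (a * k); rewrite scalezrE -mulrzr -rmorphM mulrC.
Qed.

Definition rat_mod_int : lSemiModType int :=
  bourne_quot (submod_of rat_int_subsemimod).

Definition rat_mod_int_proj : {linear zmodule rat -> rat_mod_int} :=
  bourne_proj (submod_of rat_int_subsemimod).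

Lemma rat_mod_int_proj_eq0 (r : rat) :
  rat_mod_int_proj r = 0 <-> exists k : int, r = k%:~R.
Proof.
rewrite -(linear0 rat_mod_int_proj); split.
  move=> /bourne_proj_eq[_ [_ [/submod_ofP[j ->] /submod_ofP[k ->]]]].
  rewrite add0r => e; exists (k - j).
  by rewrite rmorphB /= -e addrK.
move=> [k ->]; apply/bourne_proj_eq; exists 0, (k%:~R : rat).
by rewrite addr0 add0r; split=> //; apply/submod_ofP; [exists 0|exists k].
Qed.

Lemma rat_mod_int_baer : baer rat_mod_int.
Proof.
apply: divisible_baer => y d d0; have [r <-] := bourne_proj_surj y.
exists (rat_mod_int_proj (r / d%:~R)).
rewrite -linearZ_LR; congr bourne_pi.
by rewrite scalezrE -mulrzr mulfVK // intr_eq0.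
Qed.

End DivisibleGroups.

(** * The character module Hom_Z(S, Q/Z) *)

Section CharacterModule.
Context (S : pzSemiRingType) (n1 : S) (n1P : 1 + n1 = 0).

(** An alias of [S] carries the opposites, so that [zmodule] applies to it and [S] keeps its own
    structure. *)
Definition ring_of_neg1 of 1 + n1 = 0 : Type := S.
Local Notation R := (ring_of_neg1 n1P).
HB.instance Definition _ := GRing.PzSemiRing.on R.

Fact ring_of_neg1_addNr : left_inverse 0 (fun x : R => (n1 : R) * x) +%R.
Proof. by move=> x; rewrite -{2}[x]mul1r -mulrDl addrC [X in X * _]n1P mul0r. Qed.

HB.instance Definition _ := GRing.Nmodule_isZmodule.Build R ring_of_neg1_addNr.

Definition character : Type := homS (zmodule R) rat_mod_int.
HB.instance Definition _ := GRing.Nmodule.on character.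
Implicit Types z : character.

Definition char_val z : {linear zmodule R -> rat_mod_int} := z.

Lemma char_ext z z' : (forall r, char_val z r = char_val z' r) -> z = z'.
Proof. exact: homS_ext. Qed.

Fact char_scale_semilinear (s : S) z :
  @GRing.semilinear_for int (zmodule R) rat_mod_int *:%R
    (fun r : R => char_val z (r * (s : R))).
Proof.
split=> [k r|r r']; last by rewrite mulrDl linearD.
by rewrite -linearZ_LR; congr (char_val z _); rewrite /= scalezrE mulrzAl.
Qed.

(** Right multiplication inside the argument gives a left action. *)
Definition char_scale s z : character := linear_of (char_scale_semilinear s z).

Fact char_scaleA a b z : char_scale a (char_scale b z) = char_scale (a * b) z.
Proof. by apply: char_ext => r /=; rewrite mulrA. Qed.
Fact char_scale0 z : char_scale 0 z = 0.
Proof. by apply: char_ext => r /=; rewrite mulr0 linear0. Qed.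
Fact char_scale1 : left_id 1 char_scale.
Proof. by move=> z; apply: char_ext => r /=; rewrite mulr1. Qed.
Fact char_scaleDr : right_distributive char_scale +%R.
Proof. by move=> a z z'; apply: char_ext. Qed.
Fact char_scaleDl z : {morph char_scale^~ z : a b / a + b}.
Proof. by move=> a b; apply: char_ext => r /=; rewrite mulrDr linearD. Qed.

HB.instance Definition _ := GRing.Nmodule_isLSemiModule.Build S character
  char_scaleA char_scale0 char_scale1 char_scaleDr char_scaleDl.

Lemma char_valZ (s : S) z (r : R) : char_val (s *: z) r = char_val z (r * (s : R)).
Proof. by []. Qed.

Lemma char_valD z z' r : char_val (z + z') r = char_val z r + char_val z' r.
Proof. by []. Qed.

(** Evaluation at 1 turns the given map into an additive map to Q/Z, which extends to a character z.
    The original value y at s is recovered from y(r) = (r y)(1) = z(r s). *)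
Lemma character_baer : baer character.
Proof.
move=> G subG funG; have [G0 GD GZ] := subG.
pose H (u : zmodule R * rat_mod_int) := exists2 z, G (u.1, z) & u.2 = char_val z 1.
have subH : is_subsemimod H.
  split; first by exists 0.
    move=> u v [z Gz zE] [z' Gz' zE']; exists (z + z').
      exact: (GD (_, _) (_, _)).
    by rewrite char_valD -zE -zE'.
  move=> k u [z Gz zE]; pose c : S := (k%:~R : R); exists (c *: z).
    have := GZ c _ Gz; rewrite [X in G X](_ : _ = ((k *: u).1, c *: z)) //.
    by congr pair; rewrite /= scalezrE -mulrzl.
  by rewrite char_valZ mul1r /= zE -linearZ_LR.
have funH : functional H by move=> y [z /= /funG -> ->].
have [z zE] := baer_extend (subrr (1 : int)) rat_mod_int_baer subH funH.
exists z => s y Gsy; apply: char_ext => r; rewrite char_valZ.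
apply/esym/zE; exists ((r : S) *: y); first exact: (GZ r _ Gsy).
by rewrite char_valZ mul1r.
Qed.

Lemma character_e_injective : e_injective character.
Proof. exact: (baer_e_injective n1P character_baer). Qed.

(** On J + Zs, a map kills J and sends s to a nonzero element of Q/Z whose order divides that of s
    modulo J; it extends to a character. *)
Lemma character_separates (J : submodClosed S^o) (s : S) :
  (s : S^o) \notin J ->
  exists2 z : character, forall j : S, (j : S^o) \in J -> j *: z = 0 & s *: z <> 0.
Proof.
move=> sJ; pose P (k : int) := ((s : R) *~ k : S^o) \in J.
have JM (k : int) (x : S) : (x : S^o) \in J -> ((x : R) *~ k : S^o) \in J.
  move=> Jx; rewrite -mulrzl.
  exact: (@rpredZ S S^o J (k%:~R : R) x Jx).
have [|||d0 Pd0 d0P] := @int_ideal_generator P.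
- by rewrite /P mulr0z; apply: rpred0.
- by move=> j k Pj Pk; rewrite /P mulrzDr; apply: rpredD.
- by move=> a k Pk; rewrite /P mulrC mulrzA; apply: JM.
(* Here d is the order of s modulo [J], or 2 if that order is infinite; order 1 would put s in
   [J]. *)
have [d [d_gt1 dP]] : exists d : nat, (1 < d)%N /\ forall k, P k -> (d%:Z %| k)%Z.
  case: d0 Pd0 d0P => [|[|d]] Pd0 dP; last by exists d.+2.
    by exists 2%N; split=> // k /dP; rewrite dvd0z => /eqP->; apply: dvdz0.
  by case/negP: sJ; move: Pd0; rewrite /P mulr1z.
have dQ0 : d%:R != 0 :> rat by rewrite Num.Theory.pnatr_eq0 -lt0n ltnW.
pose y := rat_mod_int_proj (d%:R^-1).
have y0 : y <> 0.
  move=> /rat_mod_int_proj_eq0[k /(congr1 ( *%R d%:R))]; rewrite mulfV //.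
  rewrite -[d%:R]/(d%:Z%:~R) -rmorphM => /(@intr_inj rat 1) /esym/(congr1 absz).
  rewrite abszM => /eqP; rewrite muln_eq1 => /andP[/eqP d1 _].
  by move: d_gt1; rewrite -[d]/(absz d) d1.
pose G (u : zmodule R * rat_mod_int) := exists (j : R) (k : int),
  [/\ (j : S^o) \in J, u.1 = j + (s : R) *~ k & u.2 = k *: y].
have subG : is_subsemimod G.
  split.
  - by exists 0, 0; rewrite mulr0z addr0 scale0r; split=> //; apply: rpred0.
  - move=> u v [j [k [Jj uj uk]]] [j' [k' [Jj' vj vk]]].
    exists (j + j'), (k + k'); split; first exact: rpredD.
      by rewrite /= uj vj mulrzDr addrACA.
    by rewrite /= uk vk scalerDl.
  - move=> a u [j [k [Jj uj uk]]]; exists (j *~ a), (a * k).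
    split; first exact: JM.
      by rewrite /= uj scalezrE mulrzDl -mulrzA mulrC.
    by rewrite /= uk scalerA.
have funG : functional G.
  (* If j + k s = 0 then k s lies in [J], so d divides k and k [y] = 0. *)
  move=> _ [j [k [Jj /= js ->]]]; have /dP/dvdzP[q ->] : P k.
    rewrite /P; have -> : (s : R) *~ k = j *~ -1.
      by apply/eqP; rewrite mulrN1z -addr_eq0 addrC -js.
    exact: JM.
  rewrite -linearZ_LR; apply/rat_mod_int_proj_eq0; exists q.
  by rewrite scalezrE -mulrzl rmorphM /= mulfK.
have [z zE] := baer_extend (subrr (1 : int)) rat_mod_int_baer subG funG.
exists z => [j Jj|sz0].
  apply: char_ext => r; rewrite char_valZ; apply: zE; exists (r * j), 0.
  by rewrite mulr0z addr0 scale0r; split=> //; apply: (@rpredZ S S^o J (r : R)).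
have := congr1 (fun z => char_val z 1) sz0; rewrite char_valZ mul1r.
rewrite (zE s y) //; exists 0, 1; rewrite mulr1z add0r scale1r; split=> //.
exact: rpred0.
Qed.

End CharacterModule.

(** * The ascending chain condition from direct sums, and the equivalence *)

Lemma dsum_character_acc (S : pzSemiRingType) (n1 : S) (n1P : 1 + n1 = 0) :
  e_injective (dsum (fun _ : nat => character n1P)) -> left_ideals_acc S.
Proof.
move=> eE J J_inc; pose U (s : S^o) := exists n, s \in J n.
have J_le m n : (m <= n)%N -> {subset J m <= J n}.
  move=> /subnK <-; elim: (n - m)%N => // k IHk s Js.
  by rewrite addSn; apply/J_inc/IHk.
(* If [J n] is already the union, z_n = 0 will do; otherwise z_n separates [J n] from an element of
   the union. *)
have [n|z zP] := @choice nat (character n1P) (fun n z =>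
    (forall s : S, (s : S^o) \in J n -> s *: z = 0) /\
    ((forall s : S, U s -> s *: z = 0) -> forall s, U s -> s \in J n)).
  have [UJ|] := pselect (forall s, U s -> s \in J n).
    by exists 0; split=> // s _; rewrite scaler0.
  move=> /existsNP[s /not_implyP[Us /negP sJ]].
  have [z zJ sz] := character_separates n1P sJ.
  by exists z; split=> // Uz; case: sz; apply: Uz.
pose G (u : S^o * dsum (fun _ : nat => character n1P)) :=
  U u.1 /\ forall n, u.2 n = (u.1 : S) *: z n.
have subG : is_subsemimod G.
  split.
  - by split=> [|n] /=; [exists 0%N; apply: rpred0|rewrite scale0r].
  - move=> u v [[m Jm] uz] [[n Jn] vz].
    split=> [|k] /=; last by rewrite uz vz scalerDl.
    exists (maxn m n); apply: rpredD; first exact: J_le (leq_maxl m n) _ Jm.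
    exact: J_le (leq_maxr m n) _ Jn.
  - move=> a u [[m Jm] uz]; split=> [|k] /=; last by rewrite uz scalerA.
    by exists m; apply: rpredZ.
have funG : functional G.
  by move=> y [_ yz]; apply: dsum_ext => n; rewrite yz /= scale0r.
have [m mE] := e_injective_baer n1P eE subG funG.
have [N mN] : exists N, m N = 0.
  apply: contrapT => /forallNP m0; apply: infinite_nat.
  by apply: sub_finite_set (dsum_finite m) => n _; apply: m0.
have UN s : U s -> s \in J N.
  apply: (zP N).2 => {}s Us.
  (* As s lies in some [J M], it kills z_n for all n >= M. *)
  have fin : finite_set [set n | s *: z n <> 0]%classic.
    have [M Js] := Us; apply: sub_finite_set (finite_II M) => n /=.
    rewrite ltnNge => nz; apply/negP => Mn; apply: nz.
    by apply: (zP n).1; apply: J_le Js.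
  have /mE/(congr1 (fun y : dsum _ => y N)) : G (s, DSum fin) by [].
  by rewrite /= mN scaler0.
exists N => n Nn s; apply/idP/idP; last exact: J_le.
by move=> Js; apply: UN; exists n.
Qed.

Theorem theorem5p5 (S : pzSemiRingType) :
  left_noetherian_ring S <->
  (forall (I : Type) (M : I -> lSemiModType S),
     (forall i, e_injective (M i)) -> e_injective (dsum M)) /\
  (exists E : lSemiModType S, e_injective E /\ embeds (quot_neg_part S) E).
Proof.
split=> [noeth|[dsum_inj [E [eE ES]]]].
  split=> [I M|]; first exact: noetherian_dsum.
  exact: noetherian_quot_neg_part_embeds.
have ringS : is_ring S by apply: embedding_is_ring ES (dsum_inj _ _ _).
split=> //; have [n1 n1P] := ringS 1.
apply: (@dsum_character_acc S n1 n1P); apply: dsum_inj => _.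
exact: character_e_injective.
Qed.
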